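(* Let $Y$ be a real Banach space and let $A:\ell^1(\mathbb{N})\to Y$ be a bounded linear operator with non-closed range such that $Ae^{(k)}\rightharpoonup 0$ weakly in $Y$ as $k\to\infty$. Let $x^\dagger\in\ell^1(\mathbb{N})$ and $y:=Ax^\dagger$. Suppose there is $c\in[0,1)$ such that the source set $S^{(n)}(c)$ (defined in the context) is nonempty for every $n\in\mathbb{N}$. Put $\beta:=\frac{1-c}{1+c}\in(0,1]$ and, for $t\ge 0$, $$\varphi(t):=2\inf_{n\in\mathbb{N}}\left(\sum_{k=n+1}^\infty|x^\dagger_k|+\frac{t}{1+c}\inf_{(f^{(n,1)},\ldots,f^{(n,n)})\in S^{(n)}(c)}\ \sum_{k=1}^n\|f^{(n,k)}\|_{Y^*}\right).$$ Then: (a) $\varphi:[0,\infty)\to[0,\infty)$ is non-decreasing, concave and continuous with $\varphi(0)=0$, and $$\beta\|x-x^\dagger\|_{\ell^1(\mathbb{N})}\le\|x\|_{\ell^1(\mathbb{N})}-\|x^\dagger\|_{\ell^1(\mathbb{N})}+\varphi(\|Ax-Ax^\dagger\|_Y)\qquad\text{for all }x\in\ell^1(\mathbb{N}).$$ (b) Consequently, let $1\le p<\infty$ and, for each $\delta>0$, let $y^\delta\in Y$ satisfy $\|y-y^\delta\|_Y\le\delta$; for $\alpha>0$ let $x_\alpha^\delta$ be a minimizer over $x\in\ell^1(\mathbb{N})$ of $\frac1p\|Ax-y^\delta\|_Y^p+\alpha\|x\|_{\ell^1(\mathbb{N})}$. If $\alpha=\alpha(\delta,y^\delta)$ is chosen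 according to the discrepancy principle (see context), then $$\|x^\delta_{\alpha(\delta,y^\delta)}-x^\dagger\|_{\ell^1(\mathbb{N})}=\mathcal{O}(\varphi(\delta))\quad\text{as }\delta\to0.$$
   Context: $\mathbb{N}=\{1,2,\ldots\}$; all sequences are real. $e^{(k)}$ is the unit sequence with $1$ at position $k$ and $0$ elsewhere. $A^*:Y^*\to\ell^\infty(\mathbb{N})=(\ell^1(\mathbb{N}))^*$ is the adjoint, so $[A^*f]_l=\langle f,Ae^{(l)}\rangle_{Y^*\times Y}$. Source sets: for $c\in[0,1)$ and $n\in\mathbb{N}$, $S^{(n)}(c)\subseteq(Y^* )^n$ is the set of all $(f^{(n,1)},\ldots,f^{(n,n)})\in(Y^* )^n$ such that (i) for each $k\in\{1,\ldots,n\}$, $[A^*f^{(n,k)}]_k=1$ and $[A^*f^{(n,k)}]_l=0$ for $l\in\{1,\ldots,n\}\setminus\{k\}$; and (ii) $\sum_{k=1}^n|[A^*f^{(n,k)}]_l|\le c$ for all $l>n$. Existence of the minimizers $x_\alpha^\delta$ for all $\alpha>0$ is guaranteed by the weak convergence $Ae^{(k)}\rightharpoonup0$. (Sequential) discrepancy principle: fix $\tau>1$, $q\in(0,1)$, $\alpha_0>0$, and for each $\delta>0$ let $\alpha(\delta,y^\delta)$ be the largest element $\alpha$ of $\{\alpha_0q^j:\ j=0,1,2,\ldots\}$ with $\|Ax_\alpha^\delta-y^\delta\|_Y\le\tau\delta$. *)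

(* Defs.v *)
From HB Require Import structures.
From mathcomp Require Import all_boot all_order all_algebra.
From mathcomp Require Import all_classical all_reals all_analysis.

Set Implicit Arguments.
Unset Strict Implicit.
Unset Printing Implicit Defensive.

Import Order.TTheory GRing.Theory Num.Theory.
Import numFieldNormedType.Exports.

Local Open Scope classical_set_scope.
Local Open Scope ring_scope.

(* Sequences are indexed from 0: entry k of a sequence here is the entry
   usually numbered k + 1. So the first n entries are those with k < n, and
   the entries beyond the n-th are those with n <= k. *)

Section ell1_type.
Variable R : realType.

Definition ell1_pred : {pred nat -> R} :=
  fun u => `[< cvgn (series (fun k => `|u k|)) >].

Record ell1 := Ell1 { ell1_seq :> nat -> R; _ : ell1_seq \in ell1_pred }.

HB.instance Definition _ := [isSub for ell1_seq].
HB.instance Definition _ := [Choice of ell1 by <:].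

Lemma ell1P (u : nat -> R) :
  reflect (cvgn (series (fun k => `|u k|))) (u \in ell1_pred).
Proof. exact: asboolP. Qed.

Lemma ell1_submod_closed : submod_closed ell1_pred.
Proof.
split.
  apply/ell1P; rewrite (_ : series _ = cst 0); first exact: is_cvg_cst.
  by apply/funext => n; rewrite /series/= big1// => i _; rewrite normr0.
move=> a u v /ell1P cu /ell1P cv; apply/ell1P.
apply: (@series_le_cvg _ _ (fun k => `|a| * `|u k| + `|v k|)).
- by move=> k.
- by move=> k; rewrite addr_ge0// mulr_ge0.
- by move=> k; rewrite (le_trans (ler_normD _ _))// normrM.
- exact: (is_cvg_seriesD (is_cvg_seriesZ cu) cv).
Qed.

HB.instance Definition _ :=
  GRing.isSubmodClosed.Build R (nat -> R) ell1_pred ell1_submod_closed.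
HB.instance Definition _ := [SubChoice_isSubLmodule of ell1 by <:].

Lemma ell1_cvg (x : ell1) : cvgn (series (fun k => `|x k|)).
Proof. by apply/ell1P; case: x. Qed.

Definition ell1_norm (x : ell1) : R := limn (series (fun k => `|x k|)).

Lemma ell1_normD (x y : ell1) : ell1_norm (x + y) <= ell1_norm x + ell1_norm y.
Proof.
rewrite /ell1_norm -(lim_seriesD (@ell1_cvg x) (@ell1_cvg y)).
apply: lim_series_le; first exact: ell1_cvg.
  exact: (is_cvg_seriesD (@ell1_cvg x) (@ell1_cvg y)).
by move=> k; exact: ler_normD.
Qed.

Lemma ell1_normZ (a : R) (x : ell1) : ell1_norm (a *: x) = `|a| * ell1_norm x.
Proof.
rewrite /ell1_norm -[RHS](lim_seriesZ _ (@ell1_cvg x)).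
congr (limn (series _)); apply/funext => k.
exact: normrM.
Qed.

Lemma ell1_norm_ge (x : ell1) (k : nat) : `|x k| <= ell1_norm x.
Proof.
apply: (@le_trans _ _ (series (fun k => `|x k|) k.+1)).
  by rewrite /series/= big_nat_recr//= lerDr sumr_ge0.
apply: nondecreasing_cvgn_le; last exact: ell1_cvg.
by apply: nondecreasing_series => i _ _; exact: normr_ge0.
Qed.

Lemma ell1_norm0_eq0 (x : ell1) : ell1_norm x = 0 -> x = 0.
Proof.
move=> x0; apply/val_inj/funext => k /=.
by apply/eqP; rewrite -normr_le0 -x0 ell1_norm_ge.
Qed.

HB.instance Definition _ := Lmodule_isNormed.Build R ell1
  ell1_normD ell1_normZ ell1_norm0_eq0.

Lemma ell1_unit_subproof (l : nat) :
  (fun k : nat => (k == l)%:R : R) \in ell1_pred.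
Proof.
apply/ell1P; apply/cvg_ex; exists 1.
apply: cvg_near_cst; near=> n.
rewrite /series/= (bigD1_seq l) ?iota_uniq//=; last first.
  rewrite mem_index_iota leq0n/=; near: n; exact: nbhs_infty_gt.
by rewrite eqxx normr1 big1 ?addr0// => i /negPf ->; rewrite normr0.
Unshelve. all: by end_near. Qed.

Definition ell1_unit (l : nat) : ell1 := Ell1 (ell1_unit_subproof l).

End ell1_type.

Section dual_space.
Variables (R : realType) (Y : normedModType R).

Record dual := Dual { dual_fun :> {linear Y -> R}; _ : continuous dual_fun }.

Definition dual_norm (f : dual) : R :=
  sup [set `|f y| | y in [set y : Y | `|y| <= 1]].

Definition weak_cvg (u : nat -> Y) (l : Y) : Prop :=
  forall f : dual, (fun k => f (u k)) @ \oo --> f l.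

End dual_space.

Definition concave_function (R : realType) (D : set R) (f : R -> R) : Prop :=
  convex_function D (fun t => - f t).

Definition is_minimizer (R : realType) (T : Type) (F : T -> R) (x : T) : Prop :=
  forall z : T, F x <= F z.

Section adjoint.
Variables (R : realType) (Y : normedModType R) (A : ell1 R -> Y).

(* The element A^* f of ell^oo = (ell^1)^*, as a sequence. *)
Definition adjoint (f : dual Y) : nat -> R := fun l => f (A (ell1_unit R l)).

Definition source_set (c : R) (n : nat) : set ('I_n -> dual Y) :=
  [set f | (forall k : 'I_n, adjoint (f k) k = 1 /\
              forall l : 'I_n, l != k -> adjoint (f k) l = 0) /\
           (forall l : nat, (n <= l)%N ->
              \sum_(k < n) `|adjoint (f k) l| <= c)].

End adjoint.

Arguments source_set {R Y} A c n.

Section problem.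
Variables (R : realType) (Y : normedModType R) (A : ell1 R -> Y).

(* The real-valued [inf] is meaningful when all the source sets are nonempty
   and t >= 0: the sets below are then nonempty and bounded below by 0. *)
Definition source_rate (c : R) (xdag : ell1 R) (t : R) : R :=
  2 * inf [set limn (fun m => \sum_(n <= k < m) `|xdag k|) +
               t / (1 + c) *
                 inf [set \sum_(k < n) dual_norm (f k) | f in source_set A c n]
          | n in [set n : nat | (0 < n)%N]].

Definition tikhonov (p alpha : R) (ydelta : Y) (x : ell1 R) : R :=
  p^-1 * `|A x - ydelta| `^ p + alpha * `|x|.

(* [xs alpha] is the regularized solution for the parameter alpha. *)
Definition is_discrepancy_choice (tau q alpha0 delta : R) (ydelta : Y)
    (xs : R -> ell1 R) (alpha : R) : Prop :=
  let admissible := [set a | (exists j : nat, a = alpha0 * q ^+ j) /\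
                             `|A (xs a) - ydelta| <= tau * delta] in
  admissible alpha /\ ubound admissible alpha.

End problem.

(* Main.v *)
Require Import Defs.
From mathcomp Require Import all_boot all_order all_algebra.
From mathcomp Require Import all_classical all_reals all_analysis.
From mathcomp Require Import ring lra.

(* The rate [phi] is an infimum of affine functions of [t] with nonnegative
   coefficients, hence nonnegative, nondecreasing and concave; so
   [s phi(t) <= t phi(s)] for [s <= t], which gives continuity away from 0. At 0
   it follows from the tails of [xdag] tending to 0.

   Put [z = x - xdag] and let [f] be a source element of order [n]. Evaluating
   [f_k] at [A z] gives [z_k] up to an error controlled by the tail of [z], so
   [sum_(k < n) |z_k| <= (sum_k |f_k|) |A z| + c tail_n(z)]. Combined with
   [|x| - |xdag| >= tail_n(z) - sum_(k < n) |z_k| - 2 tail_n(xdag)], this is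
   the variational inequality.

   For the rate it remains to bound [|x| - |xdag|] by [O(phi(delta))] at the
   chosen parameter [alpha]; minimality bounds it by [delta^p / (p alpha)]. If
   [alpha < alpha0] then [alpha / q] violates the discrepancy principle, and
   minimality together with the variational inequality at [alpha / q] bounds
   [delta^p / (p alpha)] by a multiple of [phi(delta)]. If [alpha = alpha0],
   use that [phi(delta)] is at least a positive multiple of [delta]. *)

Set Implicit Arguments.
Unset Strict Implicit.
Unset Printing Implicit Defensive.

Import Order.TTheory GRing.Theory Num.Theory.
Import numFieldNormedType.Exports.

Local Open Scope classical_set_scope.
Local Open Scope ring_scope.

(** * Infima of affine functions with nonnegative coefficients *)

Section inf_affine.
Variables (R : realType) (I : Type) (D : set I) (a b : I -> R).
Hypotheses (D0 : D !=set0) (a_ge0 : forall i, D i -> 0 <= a i)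
  (b_ge0 : forall i, D i -> 0 <= b i).

Definition inf_affine (t : R) : R := inf [set a i + t * b i | i in D].

Lemma le_inf_affine (t x : R) :
  (forall i, D i -> x <= a i + t * b i) -> x <= inf_affine t.
Proof.
move=> xle; apply: lb_le_inf; first by case: D0 => i Di; exists (a i + t * b i), i.
by move=> _ [i Di <-]; exact: xle.
Qed.

Lemma inf_affine_le (t : R) (i : I) :
  0 <= t -> D i -> inf_affine t <= a i + t * b i.
Proof.
move=> t0 Di; apply: ge_inf; last by exists i.
exists 0 => _ [j Dj <-].
by rewrite addr_ge0 ?a_ge0 ?mulr_ge0 ?b_ge0.
Qed.

Lemma inf_affine_ge0 (t : R) : 0 <= t -> 0 <= inf_affine t.
Proof.
move=> t0; apply: le_inf_affine => i Di.
by rewrite addr_ge0 ?a_ge0 ?mulr_ge0 ?b_ge0.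
Qed.

Lemma inf_affine_homo :
  {in `[0, +oo[ &, {homo inf_affine : s t / s <= t}}.
Proof.
move=> s t; rewrite !in_itv/= !andbT => s0 t0 st.
apply: le_inf_affine => i Di; apply: (le_trans (inf_affine_le s0 Di)).
by rewrite lerD2l ler_wpM2r ?b_ge0.
Qed.

Lemma inf_affine_concave (p s t : R) : 0 <= p <= 1 -> 0 <= s -> 0 <= t ->
  p * inf_affine s + (1 - p) * inf_affine t <= inf_affine (p * s + (1 - p) * t).
Proof.
move=> /andP[p0 p1] s0 t0; have q0 : 0 <= 1 - p by rewrite subr_ge0.
apply: le_inf_affine => i Di.
rewrite [leRHS](_ : _ = p * (a i + s * b i) + (1 - p) * (a i + t * b i)); last ring.
by rewrite lerD// ler_wpM2l// inf_affine_le.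
Qed.

End inf_affine.

(** * Nonnegative nondecreasing concave functions on the half-line *)

Section concave.
Variables (R : realType) (f : R -> R).
Hypotheses (f_ge0 : forall t, 0 <= t -> 0 <= f t)
  (f_homo : {in `[0, +oo[ &, {homo f : s t / s <= t}})
  (f_concave : forall p s t, 0 <= p <= 1 -> 0 <= s -> 0 <= t ->
    p * f s + (1 - p) * f t <= f (p * s + (1 - p) * t)).

Lemma concave_ge0_ratio (s t : R) : 0 <= s -> s <= t -> s * f t <= t * f s.
Proof.
move=> s0 st; have := le_trans s0 st; rewrite le_eqVlt => /predU1P[t0|t0].
  by move: s0 st; rewrite -t0 => s0 st; rewrite (@le_anti _ _ s 0) ?st.
have := @f_concave (s / t) t 0.
rewrite divr_ge0 ?ler_pdivrMr ?mul1r ?st ?(ltW t0)// mulr0 addr0 divfK ?gt_eqF//.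
move=> /(_ isT isT (lexx 0)) fs.
suff: s / t * f t <= f s by rewrite mulrAC ler_pdivrMr// (mulrC (f s)).
apply: le_trans fs; rewrite lerDl mulr_ge0 ?f_ge0//.
by rewrite subr_ge0 ler_pdivrMr ?mul1r.
Qed.

(** For [t > 0], monotonicity and the ratio bound give [|f t - f s| * t <= |t - s| * f t] on both
    sides of [t]. Concavity says nothing about a jump at [0], so smallness there is a separate
    assumption. *)
Lemma concave_homo_continuous : f 0 = 0 ->
  (forall e : R, 0 < e -> exists2 d : R, 0 < d & f d <= e) ->
  {within `[0, +oo[, continuous f}.
Proof.
move=> f0 f_small; apply/subspace_continuousP => t; rewrite /= in_itv/= andbT => t0.
apply/cvgrPdist_le => e e0; rewrite near_withinE /from_subspace.
move: t0; rewrite le_eqVlt => /predU1P[<-|t0].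
  have [d d0 fd] := f_small _ e0.
  near=> s; rewrite /= in_itv/= andbT => s0.
  rewrite f0 sub0r normrN ger0_norm ?f_ge0//; apply: le_trans fd.
  apply: f_homo; rewrite ?in_itv/= ?andbT ?(ltW d0)//.
  move: s0; near: s; exact: lt_nbhsl_le.
have ft0 := f_ge0 (ltW t0).
(* Adding 1 keeps the denominator of the radius positive when [f t = 0]. *)
have ft1 : 0 < f t + 1 by rewrite ltr_wpDl.
near=> s; rewrite /= in_itv/= andbT => s0.
have st : `|t - s| * f t <= e * t.
  apply: (@le_trans _ _ (`|t - s| * (f t + 1))); first by rewrite ler_wpM2l ?lerDl.
  rewrite -ler_pdivlMr//; move: s0; near: s.
  have d0 : 0 < e * t / (f t + 1) by rewrite divr_gt0 ?mulr_gt0.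
  by apply: filterS (nbhsx_ballx t _ d0) => s /ltW.
have [ts|/ltW ts] := leP t s.
  have fts : f t <= f s by apply: f_homo => //; rewrite in_itv/= andbT ?(ltW t0).
  have r := concave_ge0_ratio (ltW t0) ts.
  rewrite ler0_norm ?subr_le0// in st; rewrite ler0_norm ?subr_le0//.
  by rewrite -(ler_pM2r t0); lra.
have fts : f s <= f t by apply: f_homo => //; rewrite in_itv/= andbT ?(ltW t0).
have r := concave_ge0_ratio s0 ts.
rewrite ger0_norm ?subr_ge0// in st; rewrite ger0_norm ?subr_ge0//.
by rewrite -(ler_pM2r t0); lra.
Unshelve. all: by end_near. Qed.

End concave.

(** * Tails and finite truncations of summable sequences *)

Section ell1_truncation.
Variable R : realType.
Implicit Types x z : ell1 R.

Definition ell1_tail (x : ell1 R) (n : nat) : R :=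
  limn (fun m => \sum_(n <= k < m) `|x k|).

Lemma ell1_tail_cvg (x : ell1 R) (n : nat) :
  (fun m => \sum_(n <= k < m) `|x k|) @ \oo --> ell1_tail x n.
Proof. by have := @ell1_cvg _ x; rewrite -(is_cvg_series_restrict n). Qed.

Lemma ell1_tailE (x : ell1 R) (n : nat) :
  `|x| = \sum_(k < n) `|x k| + ell1_tail x n.
Proof.
rewrite -(big_mkord predT (fun k => `|x k|)).
have xcvg : series (fun k => `|x k|) @ \oo --> `|x| by exact: (@ell1_cvg _ x).
apply: (cvg_unique _ xcvg) => //.
apply: cvg_trans (cvgD (cvg_cst _) (@ell1_tail_cvg x n)).
apply: near_eq_cvg; near=> m; rewrite /series /=.
have nm : (n <= m)%N by near: m; exact: nbhs_infty_ge.
by rewrite [RHS](big_cat_nat _ nm).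
Unshelve. all: by end_near. Qed.

Lemma ell1_tail_ge0 (x : ell1 R) (n : nat) : 0 <= ell1_tail x n.
Proof.
apply: limr_ge; first exact/cvg_ex/ex_intro/ell1_tail_cvg.
by near=> m; rewrite sumr_ge0.
Unshelve. all: by end_near. Qed.

Lemma ell1_tail_cvg0 (x : ell1 R) : ell1_tail x @ \oo --> 0.
Proof.
have xcvg : series (fun k => `|x k|) @ \oo --> `|x| by exact: (@ell1_cvg _ x).
rewrite -(subrr `|x|); apply: cvg_trans (cvgB (cvg_cst `|x|) xcvg).
apply: near_eq_cvg; near=> n.
by rewrite -[LHS]/(`|x| - \sum_(0 <= k < n) `|x k|) big_mkord (ell1_tailE x n) addrC addKr.
Unshelve. all: by end_near. Qed.

Lemma ell1_tailD (x z : ell1 R) (n : nat) :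
  ell1_tail (x + z) n <= ell1_tail x n + ell1_tail z n.
Proof.
apply: (ler_cvg_to (@ell1_tail_cvg (x + z) n)
  (cvgD (@ell1_tail_cvg x n) (@ell1_tail_cvg z n))).
near=> m.
rewrite -[leRHS]/(\sum_(n <= k < m) `|x k| + \sum_(n <= k < m) `|z k|) -big_split/=; apply: ler_sum => k _; exact: ler_normD.
Unshelve. all: by end_near. Qed.

Lemma ell1_tailN (x : ell1 R) (n : nat) : ell1_tail (- x) n = ell1_tail x n.
Proof.
congr (limn _); apply/funext => m; apply: eq_bigr => k _; exact: normrN.
Qed.

(** Written as a finite combination of unit sequences so that linear maps can be applied term by
    term. *)
Definition ell1_trunc (x : ell1 R) (m : nat) : ell1 R :=
  \sum_(k < m) x k *: ell1_unit R k.

Lemma ell1_subE (x z : ell1 R) (k : nat) : (x - z) k = x k - z k.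
Proof. by []. Qed.

Lemma ell1_truncE (x : ell1 R) (m l : nat) :
  ell1_trunc x m l = if (l < m)%N then x l else 0.
Proof.
have -> : ell1_trunc x m l = \sum_(k < m) x k * (l == k)%:R.
  rewrite /ell1_trunc; elim: m => [|m IH]; first by rewrite !big_ord0.
  by rewrite !big_ord_recr/= -IH.
case: ifPn => [lm|]; last first.
  rewrite -leqNgt => ml; rewrite big1// => k _.
  by rewrite gtn_eqF ?mulr0// (leq_trans (ltn_ord k)).
rewrite (bigD1 (Ordinal lm))//= eqxx mulr1 big1 ?addr0// => k kl.
by rewrite (_ : l == k = false) ?mulr0//; apply/negbTE; rewrite eq_sym.
Qed.

Lemma ell1_trunc_dist (x : ell1 R) (m : nat) :
  `|x - ell1_trunc x m| = ell1_tail x m.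
Proof.
rewrite (ell1_tailE _ m) big1 => [|k _]; last first.
  by rewrite ell1_subE ell1_truncE ltn_ord subrr normr0.
rewrite add0r; congr (limn _); apply/funext => n.
rewrite !big_nat; apply: eq_bigr => k /andP[mk _].
by rewrite ell1_subE ell1_truncE ltnNge mk subr0.
Qed.

Lemma ell1_trunc_cvg (x : ell1 R) : ell1_trunc x @ \oo --> x.
Proof.
apply/cvgrPdist_le => e e0; have /cvgrPdist_le/(_ _ e0) := @ell1_tail_cvg0 x.
apply: filterS => m.
by rewrite ell1_trunc_dist sub0r normrN ger0_norm ?ell1_tail_ge0.
Qed.

End ell1_truncation.

(** * Basic properties of the dual norm *)

Lemma dual_continuous (R : realType) (Y : normedModType R) (f : dual Y) :
  continuous f.
Proof. by case: f. Qed.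

Section dual_norm_theory.
Variables (R : realType) (Y : normedModType R).

Lemma dual_norm_has_sup (f : dual Y) :
  has_sup [set `|f y| | y in [set y : Y | `|y| <= 1]].
Proof.
split; first by exists `|f 0|, 0; rewrite //= normr0.
(* Every number above [K] is an operator bound for [f]; the absolute value of [K + 1] avoids
   tracking its sign. *)
have [K [_ /(_ (K + 1))]] := (linear_boundedP (f : {linear Y -> R^o})).1
  (@continuous_linear_bounded _ _ R^o 0 (f : {linear Y -> R^o}) (@dual_continuous _ _ f 0)).
rewrite ltrDl ltr01 => /(_ isT) fK.
exists `|K + 1| => _ [y /= y1 <-].
apply: le_trans (fK y) _; apply: le_trans (ler_norm _) _.
by rewrite normrM normr_id ler_piMr.
Qed.

Lemma dual_norm_ge0 (f : dual Y) : 0 <= dual_norm f.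
Proof.
have := sup_upper_bound (dual_norm_has_sup f) => /(_ `|f 0|).
rewrite linear0 normr0; apply; exists 0; rewrite /= ?normr0//.
by rewrite linear0 normr0.
Qed.

Lemma le_dual_norm (f : dual Y) (y : Y) : `|f y| <= dual_norm f * `|y|.
Proof.
have [->|y0] := eqVneq y 0; first by rewrite linear0 !normr0 mulr0.
have ny : 0 < `|y| by rewrite normr_gt0.
rewrite -ler_pdivrMr//.
apply: (sup_upper_bound (dual_norm_has_sup f)).
exists (`|y|^-1 *: y) => /=.
  by rewrite normrZ normfV normr_id mulVf// gt_eqF.
by rewrite linearZ/= normrM normfV normr_id mulrC.
Qed.

End dual_norm_theory.

(** * The variational inequality for a single source element *)

Section variational_inequality.
Variables (R : realType) (Y : normedModType R) (A : {linear ell1 R -> Y}).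
Hypothesis A_bounded : bounded_near A (nbhs (0 : ell1 R)).

Lemma dual_trunc (f : dual Y) (z : ell1 R) (m : nat) :
  f (A (ell1_trunc z m)) = \sum_(0 <= l < m) z l * adjoint A f l.
Proof.
rewrite big_mkord /ell1_trunc !linear_sum; apply: eq_bigr => l _.
by rewrite !linearZ.
Qed.

(** The unit conditions make [f k (A (ell1_trunc z m))] equal to [z k] plus terms of index at least
    [n]. Exchanging the two sums lets the column bound [c] control these errors for all [k] at
    once. *)
Lemma source_set_trunc_bound (c : R) (n m : nat) (f : 'I_n -> dual Y) (z : ell1 R) :
  source_set A c n f -> (n <= m)%N ->
  \sum_(k < n) `|z k| <= (\sum_(k < n) dual_norm (f k)) * `|A (ell1_trunc z m)| +
    c * \sum_(n <= l < m) `|z l|.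
Proof.
move=> [f_unit f_tail] nm.
have zE (k : 'I_n) : z k = f k (A (ell1_trunc z m)) -
    \sum_(n <= l < m) z l * adjoint A (f k) l.
  rewrite dual_trunc (big_cat_nat _ nm)//= addrK big_mkord (bigD1 k)//=.
  have [-> f0] := f_unit k; rewrite mulr1 big1 ?addr0// => l lk.
  by rewrite f0 ?mulr0.
apply: (@le_trans _ _ (\sum_(k < n) (dual_norm (f k) * `|A (ell1_trunc z m)| +
    \sum_(n <= l < m) `|z l| * `|adjoint A (f k) l|))).
  apply: ler_sum => k _; rewrite {1}zE; apply: le_trans (ler_normB _ _) _.
  rewrite lerD ?le_dual_norm//; apply: le_trans (ler_norm_sum _ _ _) _.
  by under eq_bigr do rewrite normrM.
rewrite big_split/= mulr_suml lerD2l exchange_big/= mulr_sumr.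
rewrite !big_nat; apply: ler_sum => l /andP[nl _].
by rewrite -mulr_sumr mulrC ler_wpM2r// f_tail.
Qed.

(** Limit [m -> oo] of the truncated bound, by continuity of [A]. *)
Lemma source_set_bound (c : R) (n : nat) (f : 'I_n -> dual Y) (z : ell1 R) :
  source_set A c n f ->
  \sum_(k < n) `|z k| <=
    (\sum_(k < n) dual_norm (f k)) * `|A z| + c * ell1_tail z n.
Proof.
move=> fS.
have Az : `|A (ell1_trunc z m)| @[m --> \oo] --> `|A z|.
  apply: cvg_norm; apply: continuous_cvg; last exact: ell1_trunc_cvg.
  exact: bounded_linear_continuous.
set F := \sum_(k < n) dual_norm (f k).
have lim : F * `|A (ell1_trunc z m)| + c * \sum_(n <= l < m) `|z l| @[m --> \oo]
    --> F * `|A z| + c * ell1_tail z n.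
    apply: cvgD; first exact: cvgMl_tmp.
  by apply: cvgMl_tmp; exact: ell1_tail_cvg.
apply: (ler_cvg_to (cvg_cst _) lim).
near=> m; apply: source_set_trunc_bound => //.
by near: m; exact: nbhs_infty_ge.
Unshelve. all: by end_near. Qed.

(** Two opposite triangle inequalities: below [n] the entries of [x] are compared with those of [z],
    beyond [n] with those of [x - z]. The tail of [z] is thus lost twice. *)
Lemma ell1_norm_diff_ge (x z : ell1 R) (n : nat) :
  ell1_tail (x - z) n - \sum_(k < n) `|(x - z) k| - 2 * ell1_tail z n <=
  `|x| - `|z|.
Proof.
have h : ell1_tail (x - z) n <= ell1_tail x n + ell1_tail z n.
  by rewrite -(ell1_tailN z); exact: ell1_tailD.
have : \sum_(k < n) `|z k| <= \sum_(k < n) `|x k| + \sum_(k < n) `|(x - z) k|.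
  rewrite -big_split; apply: ler_sum => k _.
  by apply: le_trans (ler_normB (x k) ((x - z) k)); rewrite ell1_subE subKr.
rewrite (ell1_tailE x n) (ell1_tailE z n); lra.
Qed.

Lemma source_set_variational (c : R) (n : nat) (f : 'I_n -> dual Y)
    (x z : ell1 R) : 0 <= c -> source_set A c n f ->
  (1 - c) / (1 + c) * `|x - z| <= `|x| - `|z| +
    2 * (ell1_tail z n + `|A x - A z| / (1 + c) * \sum_(k < n) dual_norm (f k)).
Proof.
move=> c0 fS; have c1 : 0 < 1 + c by rewrite ltr_wpDr.
have := source_set_bound (x - z) fS; have := ell1_norm_diff_ge x z n.
rewrite linearB (ell1_tailE (x - z) n).
set F := \sum_(k < n) dual_norm _; set d := `|A x - A z|.
set s := \sum_(k < n) _; set t := ell1_tail (x - z) n => h1 h2.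
apply: le_trans (lerD h1 (lexx _)).
(* After multiplication by [1 + c], the two sides differ by [2 * (F * d + c * t - s)], which [h2]
   makes nonnegative. *)
rewrite -(ler_pM2l c1).
rewrite [leLHS](_ : _ = (1 - c) * (s + t)); last by field; rewrite gt_eqF.
rewrite [leRHS](_ : _ = (1 + c) * (t - s) + 2 * (F * d)); last by field; rewrite gt_eqF.
lra.
Qed.

End variational_inequality.

(** The case [k = 0] is treated apart, since one cannot divide by [k]; it occurs below when
    [A x = A xdag]. *)
Lemma le_scale_inf (R : realType) (S : set R) (x a k : R) : S !=set0 -> 0 <= k ->
  (forall s, S s -> x <= a + k * s) -> x <= a + k * inf S.
Proof.
move=> S0; rewrite le_eqVlt => /predU1P[<-|k0] xle.
  by case: S0 => s /xle; rewrite !mul0r.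
rewrite -lerBlDl -ler_pdivrMl//; apply: lb_le_inf => // s /xle.
by rewrite -lerBlDl -ler_pdivrMl.
Qed.

(** * Properties of the rate function *)

Section source_rate_theory.
Variables (R : realType) (Y : normedModType R) (A : {linear ell1 R -> Y}).
Variables (xdag : ell1 R) (c : R).
Hypotheses (c_ge0 : 0 <= c)
  (source_nonempty : forall n : nat, (0 < n)%N -> source_set A c n !=set0).

Let source_norm (n : nat) : R :=
  inf [set \sum_(k < n) dual_norm (f k) | f in source_set A c n].

Let phi := source_rate A c xdag.

Let pos_nat : set nat := [set n | (0 < n)%N].

Let psi := inf_affine pos_nat (ell1_tail xdag) (fun n => source_norm n / (1 + c)).

Lemma source_rateE (t : R) : phi t = 2 * psi t.
Proof.
congr (2 * inf _); apply: eq_imagel => n _.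
by rewrite mulrAC -mulrA.
Qed.

Let onec_gt0 : 0 < 1 + c. Proof. by rewrite ltr_wpDr. Qed.

Let pos_nat_neq0 : pos_nat !=set0. Proof. by exists 1%N. Qed.

Lemma source_norm_set_neq0 (n : nat) : (0 < n)%N ->
  [set \sum_(k < n) dual_norm (f k) | f in source_set A c n] !=set0.
Proof. by move=> /source_nonempty[f fS]; exists (\sum_(k < n) dual_norm (f k)), f. Qed.

Lemma source_norm_ge0 (n : nat) : pos_nat n -> 0 <= source_norm n / (1 + c).
Proof.
move=> n0; rewrite divr_ge0 ?(ltW onec_gt0)//.
apply: lb_le_inf; first exact: source_norm_set_neq0.
by move=> _ [f _ <-]; apply: sumr_ge0 => k _; exact: dual_norm_ge0.
Qed.

Let tail_ge0 (n : nat) : pos_nat n -> 0 <= ell1_tail xdag n.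
Proof. by move=> _; exact: ell1_tail_ge0. Qed.

Lemma source_rate_ge0 (t : R) : 0 <= t -> 0 <= phi t.
Proof.
move=> t0; rewrite source_rateE mulr_ge0//.
exact: (inf_affine_ge0 pos_nat_neq0 tail_ge0 source_norm_ge0).
Qed.

Lemma source_rate_homo : {in `[0, +oo[ &, {homo phi : s t / s <= t}}.
Proof.
move=> s t s0 t0 st; rewrite !source_rateE ler_pM2l//.
exact: (inf_affine_homo pos_nat_neq0 tail_ge0 source_norm_ge0).
Qed.

Lemma source_rate_concave (p s t : R) : 0 <= p <= 1 -> 0 <= s -> 0 <= t ->
  p * phi s + (1 - p) * phi t <= phi (p * s + (1 - p) * t).
Proof.
move=> p01 s0 t0; rewrite !source_rateE.
have := inf_affine_concave pos_nat_neq0 tail_ge0 source_norm_ge0 p01 s0 t0.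
rewrite -/psi; lra.
Qed.

Lemma source_rate_small (e : R) : 0 < e -> exists2 d : R, 0 < d & phi d <= e.
Proof.
move=> e0; have e4 : 0 < e / 4 by rewrite divr_gt0.
have /cvgrPdist_le/(_ _ e4) [N _ tailN] := @ell1_tail_cvg0 _ xdag.
have := tailN N.+1 (leqnSn N); rewrite sub0r normrN ger0_norm ?ell1_tail_ge0// => tailNe.
have b0 := @source_norm_ge0 N.+1 isT; set b := source_norm _ / _ in b0.
have b1 : 0 < b + 1 by rewrite ltr_wpDl.
(* Tail and linear term each get [e / 4], because the rate carries a factor 2. *)
exists (e / 4 / (b + 1)); first by rewrite divr_gt0.
rewrite source_rateE.
have : psi (e / 4 / (b + 1)) <= ell1_tail xdag N.+1 + e / 4 / (b + 1) * b.
  by apply: (inf_affine_le tail_ge0 source_norm_ge0); rewrite // ltW// divr_gt0.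
have : e / 4 / (b + 1) * b <= e / 4.
  by rewrite mulrAC ler_pdivrMr// ler_pM2l// lerDl.
lra.
Qed.

Lemma source_rate0 : phi 0 = 0.
Proof.
apply/le_anti; rewrite source_rate_ge0// andbT; apply/ler_addgt0Pl => e e0.
have [d d0 phid] := source_rate_small e0; rewrite addr0; apply: le_trans phid.
by apply: source_rate_homo; rewrite ?in_itv/= ?lexx ?(ltW d0).
Qed.

Lemma source_rate_continuous : {within `[0, +oo[, continuous phi}.
Proof.
exact: (concave_homo_continuous source_rate_ge0 source_rate_homo
  source_rate_concave source_rate0 source_rate_small).
Qed.

(* With [e] the first unit sequence, the first component [f] of a source element
   satisfies [1 = f (A e) <= |f| |A e|], so the slopes of the affine functions
   defining the rate are bounded below by a positive constant. *)
Lemma source_rate_ge_linear :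
  exists2 k : R, 0 < k & forall t : R, 0 <= t -> k * t <= phi t.
Proof.
have unit_bound (f : dual Y) :
    adjoint A f 0 = 1 -> `|A (ell1_unit R 0)|^-1 <= dual_norm f /\ 0 < `|A (ell1_unit R 0)|.
  move=> f1; have := le_dual_norm f (A (ell1_unit R 0)).
  rewrite -/(adjoint A f 0) f1 normr1 => fA.
  have A0 : 0 < `|A (ell1_unit R 0)|.
    rewrite lt_neqAle normr_ge0 andbT; apply: contraTneq fA => <-.
    by rewrite mulr0 -ltNge.
  by split => //; rewrite -div1r ler_pdivrMr.
set g := `|A (ell1_unit R 0)|^-1.
have g0 : 0 < g.
  have [f [/(_ ord0)[/unit_bound[_]]]] := @source_nonempty 1%N isT.
  by rewrite invr_gt0.
exists (2 * (g / (1 + c))); first by rewrite mulr_gt0// divr_gt0.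
move=> t t0; rewrite source_rateE -mulrA ler_pM2l//.
apply: (le_inf_affine pos_nat_neq0) => n n0.
rewrite mulrC -[leLHS]add0r lerD ?ell1_tail_ge0// ler_wpM2l//.
rewrite ler_pM2r ?invr_gt0//.
apply: lb_le_inf; first exact: source_norm_set_neq0.
move=> _ [f [fS _] <-]; case: n n0 f fS => // n _ f fS.
rewrite big_ord_recl; have [/unit_bound[gf _] _] := fS ord0.
by rewrite -[leLHS]addr0 lerD// sumr_ge0// => k _; exact: dual_norm_ge0.
Qed.

(** The inequality for a single source element holds for every order and every element, so both
    infima can be taken on the right. *)
Lemma source_rate_variational (x : ell1 R) :
  bounded_near A (nbhs (0 : ell1 R)) ->
  (1 - c) / (1 + c) * `|x - xdag| <= `|x| - `|xdag| + phi `|A x - A xdag|.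
Proof.
move=> A_bounded; rewrite -lerBlDl source_rateE -ler_pdivrMl//.
apply: (le_inf_affine pos_nat_neq0) => n n0.
have -> : `|A x - A xdag| * (source_norm n / (1 + c)) =
    `|A x - A xdag| / (1 + c) * source_norm n by rewrite mulrA mulrAC.
 apply: le_scale_inf; first exact: source_norm_set_neq0.
  by rewrite divr_ge0 ?(ltW onec_gt0).
move=> _ [f fS <-]; rewrite ler_pdivrMl// lerBlDl.
exact: source_set_variational.
Qed.

End source_rate_theory.

(** * Error bounds for the discrepancy principle, for an abstract rate *)

Section discrepancy_principle.
Variables (R : realType) (Y : normedModType R) (A : ell1 R -> Y) (xdag : ell1 R).
Variables (beta : R) (phi : R -> R).
Hypotheses (beta_gt0 : 0 < beta) (phi_ge0 : forall t, 0 <= t -> 0 <= phi t)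
  (phi_homo : {in `[0, +oo[ &, {homo phi : s t / s <= t}})
  (phi_ratio : forall s t, 0 <= s -> s <= t -> s * phi t <= t * phi s)
  (variational : forall x : ell1 R,
     beta * `|x - xdag| <= `|x| - `|xdag| + phi `|A x - A xdag|).

Lemma tikhonov_minimizer_le (p a delta : R) (y : Y) (x : ell1 R) :
  1 <= p -> `|A xdag - y| <= delta -> is_minimizer (tikhonov A p a y) x ->
  p^-1 * `|A x - y| `^ p + a * `|x| <= p^-1 * delta `^ p + a * `|xdag|.
Proof.
move=> p1 yd /(_ xdag) /le_trans; apply; rewrite lerD2r.
rewrite ler_wpM2l ?invr_ge0 ?(le_trans ler01)//.
by apply: ge0_ler_powR; rewrite ?nnegrE ?(le_trans _ yd)// (le_trans ler01).
Qed.

(** With [s] the residual divided by [delta], minimality bounds [|x| - |xdag|] above and the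
    variational inequality bounds it below, giving [(s - 1) P <= (s + 1) G]. Since
    [(s + 1) / (s - 1)] decreases in [s], [tau] may replace [s]. *)
Lemma large_residual_parameter_bound (p a delta tau : R) (y : Y) (x : ell1 R) :
  1 <= p -> 0 < a -> 0 < delta -> 1 < tau ->
  `|A xdag - y| <= delta -> is_minimizer (tikhonov A p a y) x ->
  tau * delta < `|A x - y| ->
  (tau - 1) * (p^-1 * delta `^ p) <= (tau + 1) * (a * phi delta).
Proof.
move=> p1 a0 delta0 tau1 yd xmin dtau.
have p0 : 0 < p by rewrite (lt_le_trans ltr01).
pose d := `|A x - y|; pose s := d / delta.
have taus : tau < s by rewrite ltr_pdivlMr.
have dE : d = s * delta by rewrite divfK// gt_eqF.
have s1 : 1 < s by rewrite (lt_trans tau1).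
(* Uses [s <= s^p], valid as [1 <= s] and [1 <= p]. *)
have dp : s * delta `^ p <= d `^ p.
  rewrite dE powRM ?(ltW delta0) ?(le_trans ler01 (ltW s1))//.
  by rewrite ler_wpM2r ?powR_ge0// le1r_powR// ltW.
have min_le := tikhonov_minimizer_le p1 yd xmin.
have residual : `|A x - A xdag| <= (s + 1) * delta.
  rewrite mulrDl mul1r -dE; apply: le_trans (ler_distD y _ _) _.
  by rewrite lerD2l distrC.
have phi_le : phi `|A x - A xdag| <= (s + 1) * phi delta.
  apply: (@le_trans _ _ (phi ((s + 1) * delta))).
    apply: phi_homo => //; rewrite in_itv/= andbT ?normr_ge0//.
    exact: le_trans residual.
  rewrite -(ler_pM2l delta0) mulrCA mulrA; apply: phi_ratio; first exact: ltW.
  by rewrite ler_peMl ?(ltW delta0)// lerDr ltW// (lt_trans ltr01).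
have var : 0 <= `|x| - `|xdag| + (s + 1) * phi delta.
  apply: le_trans (le_trans (variational x) _); last by rewrite lerD2l.
  by rewrite mulr_ge0// ltW.
have : (s - 1) * (p^-1 * delta `^ p) <= (s + 1) * (a * phi delta).
  have : p^-1 * (s * delta `^ p) <= p^-1 * d `^ p by rewrite ler_wpM2l// invr_ge0 ltW.
  have : 0 <= a * (`|x| - `|xdag| + (s + 1) * phi delta) by rewrite mulr_ge0// ltW.
  rewrite -/d in min_le; lra.
have P0 : 0 <= p^-1 * delta `^ p by rewrite mulr_ge0 ?powR_ge0 ?invr_ge0 ?ltW.
have G0 : 0 <= a * phi delta by rewrite mulr_ge0 ?phi_ge0 ?ltW.
move: (p^-1 * _) (a * _) P0 G0 => P G P0 G0 PG.
have s10 : 0 < s - 1 by rewrite subr_gt0.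
rewrite -(ler_pM2l s10).
have : (tau - 1) * ((s - 1) * P) <= (tau - 1) * ((s + 1) * G).
  by rewrite ler_wpM2l// subr_ge0 ltW.
have : tau * G <= s * G by rewrite ler_wpM2r// ltW.
lra.
Qed.

(** In the constant, the first two summands cover [alpha < alpha0] and [alpha = alpha0]; the third
    comes from the rate at [|A (xs alpha) - A xdag| <= (tau + 1) * delta]. *)
Lemma discrepancy_bound (p tau q alpha0 k delta alpha : R) (y : Y)
    (xs : R -> ell1 R) :
  1 <= p -> 1 < tau -> 0 < q < 1 -> 0 < alpha0 -> 0 < k ->
  k * delta <= phi delta -> 0 < delta <= 1 -> `|A xdag - y| <= delta ->
  (forall a, 0 < a -> is_minimizer (tikhonov A p a y) (xs a)) ->
  is_discrepancy_choice A tau q alpha0 delta y xs alpha ->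
  `|xs alpha - xdag| <=
    beta^-1 * ((tau + 1) / (tau - 1) / q + (alpha0 * k)^-1 + (tau + 1)) * phi delta.
Proof.
move=> p1 tau1 /andP[q0 q1] alpha00 k0 kphi /andP[delta0 delta1] yd xmin.
move=> [[[j alphaE] residual] alpha_max].
have p0 : 0 < p by rewrite (lt_le_trans ltr01).
have tau10 : 0 < tau - 1 by rewrite subr_gt0.
have phi0 := phi_ge0 (ltW delta0).
have alpha_gt0 : 0 < alpha by rewrite alphaE mulr_gt0// exprn_gt0.
have C1 : 0 <= (tau + 1) / (tau - 1) / q * phi delta.
  rewrite mulr_ge0// divr_ge0 ?(ltW q0)// divr_ge0 ?(ltW tau10)//.
  by rewrite addr_ge0// ltW// (lt_trans ltr01).
have C2 : 0 <= (alpha0 * k)^-1 * phi delta.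
  by rewrite mulr_ge0// invr_ge0 mulr_ge0// ltW.
have excess : p^-1 * delta `^ p <=
    alpha * (((tau + 1) / (tau - 1) / q + (alpha0 * k)^-1) * phi delta).
  case: j alphaE => [|j] alphaE.
    (* Here [alpha = alpha0], and no larger grid point is available: [delta <= 1] gives
       [delta^p <= delta], which is at most [phi delta / k]. *)
    rewrite expr0 mulr1 in alphaE.
    apply: (@le_trans _ _ (alpha * ((alpha0 * k)^-1 * phi delta))); last first.
      by rewrite ler_pM2l// mulrDl lerDr.
    rewrite alphaE invfM !mulrA divff ?gt_eqF// mul1r ler_pdivlMl//; apply: le_trans kphi; rewrite ler_pM2l//.
    apply: (@le_trans _ _ (delta `^ p)).
      by rewrite ler_piMl ?powR_ge0// invf_le1.
    by apply: ge1r_powR; rewrite ?delta0.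
  (* The preceding grid point [a = alpha / q] exceeds [alpha], so by maximality it is not
     admissible. *)
  pose a := alpha0 * q ^+ j.
  have a0 : 0 < a by rewrite mulr_gt0// exprn_gt0.
  have aE : alpha = a * q by rewrite alphaE exprSr mulrA.
  have large : tau * delta < `|A (xs a) - y|.
    rewrite ltNge; apply/negP => small.
    have : a <= alpha by apply: alpha_max; split => //; exists j.
    by rewrite aE leNgt gtr_pMr ?q1.
  have := large_residual_parameter_bound p1 a0 delta0 tau1 yd (xmin a a0) large.
  rewrite -ler_pdivlMl// => /le_trans; apply.
  apply: (@le_trans _ _ (alpha * ((tau + 1) / (tau - 1) / q * phi delta))).
    rewrite aE le_eqVlt; apply/orP; left; apply/eqP; field.
    by rewrite !gt_eqF.
  by rewrite ler_pM2l// [leRHS]mulrDl lerDl.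
(* Minimality at [alpha] with the residual term dropped, followed by division by [alpha]. *)
have xle : `|xs alpha| - `|xdag| <=
    ((tau + 1) / (tau - 1) / q + (alpha0 * k)^-1) * phi delta.
  rewrite -(ler_pM2l alpha_gt0); apply: le_trans excess.
  rewrite mulrBr lerBlDr; apply: le_trans (tikhonov_minimizer_le p1 yd (xmin _ alpha_gt0)).
  by rewrite lerDr mulr_ge0 ?powR_ge0// invr_ge0 ltW.
have phi_le : phi `|A (xs alpha) - A xdag| <= (tau + 1) * phi delta.
  have tau0 : 0 < tau by rewrite (lt_trans ltr01).
  have res : `|A (xs alpha) - A xdag| <= (tau + 1) * delta.
    rewrite mulrDl mul1r; apply: le_trans (ler_distD y _ _) _.
    by rewrite lerD// distrC.
  apply: (@le_trans _ _ (phi ((tau + 1) * delta))).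
    apply: phi_homo => //; rewrite in_itv/= andbT ?normr_ge0//.
    exact: le_trans res.
  rewrite -(ler_pM2l delta0) mulrCA mulrA; apply: phi_ratio; first exact: ltW.
  by rewrite ler_peMl ?(ltW delta0)// lerDr ltW.
rewrite -mulrA ler_pdivlMl// mulrDl.
exact: le_trans (variational _) (lerD xle phi_le).
Qed.

End discrepancy_principle.

Theorem theorem3p6 (R : realType) (Y : completeNormedModType R)
    (A : {linear ell1 R -> Y})
    (A_bounded : bounded_near A (nbhs (0 : ell1 R)))
    (A_range : ~ closed (range A))
    (A_weak : weak_cvg (fun k => A (ell1_unit R k)) 0)
    (xdag : ell1 R) (c : R) (c_ge0 : 0 <= c) (c_lt1 : c < 1)
    (source_nonempty : forall n : nat, (0 < n)%N -> source_set A c n !=set0) :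
  let beta := (1 - c) / (1 + c) in
  let phi := source_rate A c xdag in
  [/\ forall t : R, 0 <= t -> 0 <= phi t,
      {in `[0, +oo[ &, {homo phi : s t / s <= t}},
      concave_function `[0, +oo[ phi,
      {within `[0, +oo[, continuous phi} &
      phi 0 = 0] /\
  (forall x : ell1 R,
     beta * `|x - xdag| <= `|x| - `|xdag| + phi `|A x - A xdag|) /\
  (forall (p tau q alpha0 : R),
     1 <= p -> 1 < tau -> 0 < q < 1 -> 0 < alpha0 ->
   forall ydelta : R -> Y,
     (forall delta : R, 0 < delta -> `|A xdag - ydelta delta| <= delta) ->
   forall xs : R -> R -> ell1 R,
     (forall delta alpha : R, 0 < delta -> 0 < alpha ->
        is_minimizer (tikhonov A p alpha (ydelta delta)) (xs delta alpha)) ->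
   forall alpha : R -> R,
     (forall delta : R, 0 < delta ->
        is_discrepancy_choice A tau q alpha0 delta (ydelta delta)
          (xs delta) (alpha delta)) ->
   (fun delta : R => `|xs delta (alpha delta) - xdag|) =O_ (0^'+) phi).

Proof.
move=> beta phi.
have beta_gt0 : 0 < beta by rewrite divr_gt0 ?subr_gt0// ltr_wpDr.
have phi_ge0 := source_rate_ge0 xdag c_ge0 source_nonempty.
have phi_homo := source_rate_homo xdag c_ge0 source_nonempty.
have phi_concave := source_rate_concave xdag c_ge0 source_nonempty.
have phi_var x := source_rate_variational xdag c_ge0 source_nonempty x A_bounded.
split; [split => //|split => //].
- move=> t x y; rewrite !inE/= !in_itv/= !andbT => x0 y0.
  have := phi_concave t%:inum x y; rewrite ge0 le1 => /(_ isT x0 y0).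
  by rewrite -lerN2 opprD -!mulrN.
- exact: source_rate_continuous.
- exact: source_rate0.
move=> p tau q alpha0 p1 tau1 q01 alpha00 ydelta yd xs xmin alpha choice.
have [k k0 kphi] := source_rate_ge_linear xdag c_ge0 source_nonempty.
have phi_ratio := concave_ge0_ratio phi_ge0 phi_concave.
apply/eqO_exP.
exists (beta^-1 * ((tau + 1) / (tau - 1) / q + (alpha0 * k)^-1 + (tau + 1))).
  have [[q0 _] tau0] := (andP q01, lt_trans ltr01 tau1).
  rewrite mulr_gt0 ?invr_gt0// ltr_wpDl ?addr_gt0//.
  by rewrite addr_ge0 ?invr_ge0 ?divr_ge0 ?mulr_ge0 ?subr_ge0 ?addr_ge0// ltW.
near=> delta.
have delta0 : 0 < delta by near: delta; exact: nbhs_right_gt.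
(* The constant is uniform only over [delta] in [(0, 1]], which suffices near [0]. *)
have delta1 : delta <= 1 by near: delta; exact: nbhs_right_le.
rewrite normr_id (ger0_norm (phi_ge0 _ (ltW delta0))).
apply: (discrepancy_bound beta_gt0 phi_ge0 phi_homo phi_ratio phi_var p1 tau1 q01
  alpha00 k0 (kphi _ (ltW delta0)) _ (yd _ delta0)).
- by rewrite delta0.
- by move=> a; exact: xmin.
- exact: choice.
Unshelve. all: by end_near. Qed.
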